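(* Suppose $G$ is a graph with $n$ vertices and $k$ connected components. Let the sizes (numbers of vertices) of these components be $h_1, h_2, \ldots, h_k$ respectively, with $h_1 \le h_2 \le \cdots \le h_k$. Then $P = \{p_1, p_2, \ldots, p_k\}$, where $p_i = \sum_{j=1}^i h_j$ for $i = 1, 2, \ldots, k$, is the minimum element of $\mathcal{P}(G,k)$.
   Context: Graphs are finite and simple, and $[n] = \{1,2,\ldots,n\}$. A labeling of a graph $G$ with $n$ vertices is a bijection $\lambda : V(G) \to [n]$. The label $\lambda(u)$ of a vertex $u$ is a pinnacle of $(G,\lambda)$ if $\lambda(u) > \lambda(v)$ for every neighbor $v$ of $u$ (so the label of an isolated vertex is vacuously a pinnacle). The pinnacle set of $(G,\lambda)$ is the set of all pinnacles of $(G,\lambda)$. A subset $S \subseteq [n]$ is a pinnacle set of $G$ if there is a labeling $\lambda$ of $G$ such that $S$ is the pinnacle set of $(G,\lambda)$. $\mathrm{Pin}(G,k)$ denotes the collection of all size-$k$ pinnacle sets of $G$. For $P = \{p_1 < p_2 < \cdots < p_k\}$ and $Q = \{q_1 < q_2 < \cdots < q_k\}$ in $\mathrm{Pin}(G,k)$, define $P \preceq Q$ if and only if $p_i \le q_i$ for $i = 1, \ldots, k$. Then $\mathcal{P}(G,k) = (\mathrm{Pin}(G,k), \preceq)$ is a partial order. A minimum element is one that is $\preceq$ every element of the poset. *)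

(* Defs.v *)
From mathcomp Require Import all_boot.

Set Implicit Arguments.
Unset Strict Implicit.
Unset Printing Implicit Defensive.

(* A finite simple graph is a symmetric irreflexive relation e : rel V on a
   finType V; these two properties are hypotheses of the theorem. *)

(* [n] = {1, ..., n}: elements of 'I_n.+1 carry their true value, and 0 is
   excluded, so no shift of labels is involved. *)
Definition interval (n : nat) : {set 'I_n.+1} := [set x : 'I_n.+1 | 0 < x].

Section Pinnacles.

Variables (V : finType) (e : rel V) (n : nat).
Implicit Types (lam : {ffun V -> 'I_n.+1}) (S P Q : {set 'I_n.+1}) (k : nat).

Definition labeling lam : bool :=
  injectiveb lam && ([set lam u | u : V] == interval n).

Definition is_pinnacle lam (u : V) : bool :=
  [forall v, e u v ==> (lam v < lam u)].

Definition pinnacles lam : {set 'I_n.+1} :=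
  [set lam u | u : V & is_pinnacle lam u].

Definition is_pinnacle_set S : bool :=
  (S \subset interval n) &&
  [exists lam : {ffun V -> 'I_n.+1}, labeling lam && (pinnacles lam == S)].

Definition Pin k : {set {set 'I_n.+1}} :=
  [set S : {set 'I_n.+1} | (#|S| == k) && is_pinnacle_set S].

(* Indices start at 0: nth 0 (increasing P) i is the element p_{i+1} of P. *)
Definition increasing P : seq nat := sort leq [seq val x | x in P].

Definition pin_le k P Q : bool :=
  [forall i : 'I_k, nth 0 (increasing P) i <= nth 0 (increasing Q) i].

Definition components : {set {set V}} :=
  equivalence_partition (connect e) [set: V].

Lemma size_increasing P : size (increasing P) = #|P|.
Proof. by rewrite size_sort size_image. Qed.

Lemma mem_increasing P (x : 'I_n.+1) : (val x \in increasing P) = (x \in P).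
Proof. by rewrite mem_sort mem_image //; apply: val_inj. Qed.

(* pin_le k is a partial order on Pin k. *)
Lemma pin_le_refl k P : pin_le k P P.
Proof. exact/forallP. Qed.

Lemma pin_le_trans k : transitive (pin_le k).
Proof.
move=> Q P S /forallP hPQ /forallP hQS; apply/forallP => i.
exact: leq_trans (hPQ i) (hQS i).
Qed.

Lemma pin_le_anti k : {in Pin k &, antisymmetric (pin_le k)}.
Proof.
move=> P Q; rewrite !inE => /andP[/eqP cP _] /andP[/eqP cQ _].
move=> /andP[/forallP hPQ /forallP hQP]; apply/setP => x.
rewrite -!mem_increasing; congr (_ \in _).
apply: (@eq_from_nth _ 0); rewrite !size_increasing ?cP ?cQ // => i ltik.
by apply/eqP; rewrite eqn_leq (hPQ (Ordinal ltik)) (hQP (Ordinal ltik)).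
Qed.

End Pinnacles.

Definition minimum_of (X : finType) (A : {set X}) (le : rel X) (x : X) : Prop :=
  x \in A /\ {in A, forall y, le x y}.

(* The set {p_1, ..., p_k} with p_i = h_1 + ... + h_i.  A partial sum exceeding
   n would be dropped; this does not happen when the h_j are component sizes of
   a graph on n vertices, since they then add up to n. *)
Definition partial_sums (n k : nat) (h : k.-tuple nat) : {set 'I_n.+1} :=
  [set x : 'I_n.+1 |
    [exists i : 'I_k, val x == \sum_(j < k | j <= i) tnth h j]].

(* Main.v *)
Require Import Defs.
From mathcomp Require Import all_boot zify.

(** Every connected component contains a pinnacle, namely its largest label,
    so a labeling with as many pinnacles as components has exactly one pinnacle
    per component, and this pinnacle bounds all labels of its component.

    Minimality: let Q be the set of pinnacles of such a labeling, and suppose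
    that m elements of Q are at most x.  Then all the labels of the
    corresponding m components lie in [1, x], so the sizes of these components
    add up to at most x ([sumn_take_count_upto]).  The m smallest sizes add up
    to no more than that ([sumn_take_le_perm]), so p_m <= x and at least m
    of the partial sums are at most x ([count_upto_partial_sums]).  Comparing
    these counts for all x is the same as comparing the two sets entry by
    entry ([pin_le_count_upto]).

    Attainment: choose a root in each component and label the components one
    after the other by increasing size, each of them from its farthest vertices
    down to its root.  A vertex that is not a root has a neighbor closer to the
    root, hence with a larger label, so the pinnacles are the labels of the
    roots, and the label of the root of the i-th component is the number of
    vertices of the first i components ([pinnacles_block_labeling]). *)

Set Implicit Arguments.
Unset Strict Implicit.
Unset Printing Implicit Defensive.

(** * Sums over sequences *)

Lemma sumn_take_le_subseq (h s : seq nat) :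
  sorted leq h -> subseq s h -> sumn (take (size s) h) <= sumn s.
Proof.
elim: h s => [|x h IHh] [|y s] //= h_sorted.
have sorted_tl : sorted leq h by apply: path_sorted h_sorted.
case: eqP => [-> /(IHh _ sorted_tl)|_ sub_ys]; first by rewrite leq_add2l.
apply: leq_add; last first.
  exact: (IHh _ sorted_tl (subseq_trans (subseq_cons s y) sub_ys)).
have y_in : y \in h by apply: (mem_subseq sub_ys); rewrite mem_head.
by move: h_sorted; rewrite (path_sortedE leq_trans) => /andP[/allP/(_ _ y_in)].
Qed.

(** The smallest entries have the smallest sum.  Sorting both sequences keeps
    the subsequence relation, which reduces this to the sorted case. *)
Lemma sumn_take_le_perm (h t s : seq nat) :
  sorted leq h -> perm_eq h t -> subseq s t -> sumn (take (size s) h) <= sumn s.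
Proof.
move=> h_sorted h_t sub_s.
have sort_t : sort leq t = h.
  apply: (sorted_eq leq_trans anti_leq) => //.
    exact: sort_sorted leq_total _.
  by rewrite perm_sort perm_sym.
rewrite -(size_sort leq s) -(perm_sumn (permEl (perm_sort leq s))).
apply: sumn_take_le_subseq => //; rewrite -sort_t.
exact: (subseq_sort leq_total leq_trans).
Qed.

Lemma mixed_radix_lt N a b r s : r < N -> a < b -> a * N + r < b * N + s.
Proof. by nia. Qed.

Lemma subset_enum_subseq (T : finType) (A B : {set T}) :
  A \subset B -> subseq (enum A) (enum B).
Proof.
move=> /subsetP sAB; have -> : enum A = [seq x <- enum B | x \in A].
  rewrite {1 2}/enum_mem -filter_predI; apply: eq_filter => x /=.
  by case xA: (x \in A) => //=; rewrite sAB.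
exact: filter_subseq.
Qed.

Lemma sumn_take_tnth k (h : k.-tuple nat) m : m <= k ->
  \sum_(j < k | j < m) tnth h j = sumn (take m h).
Proof.
move=> le_mk; rewrite sumnE (big_nth 0) size_takel ?size_tuple // big_mkord.
rewrite (big_ord_widen k (fun j => nth 0 (take m h) j) le_mk).
by apply: eq_bigr => j lt_jm; rewrite nth_take // (tnth_nth 0).
Qed.

Lemma sumn_take_lt (h : seq nat) a b :
  all (ltn 0) h -> b <= size h -> a < b -> sumn (take a h) < sumn (take b h).
Proof.
elim: h a b => [|x h IHh] [|a] [|b] //= /andP[x_gt0 h_gt0] le_b lt_ab.
  by rewrite addn_gt0 x_gt0.
by rewrite ltn_add2l IHh.
Qed.

Lemma sumn_take_le (h : seq nat) m : sumn (take m h) <= sumn h.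
Proof. by rewrite -{2}(cat_take_drop m h) sumn_cat leq_addr. Qed.

(** * Entrywise comparison by counting *)

Lemma sorted_nth_leE (s : seq nat) i x :
  sorted leq s -> i < size s -> (nth 0 s i <= x) = (i < count (leq^~ x) s).
Proof.
elim: s i => [|y s IHs] //= i ys_sorted; have s_sorted := path_sorted ys_sorted.
move: ys_sorted; rewrite (path_sortedE leq_trans) => /andP[/allP y_le _].
case: (leqP y x) => [yx|xy].
  by case: i => [|i] //= lt_i; rewrite IHs.
move=> lt_i; rewrite add0n.
have -> : count (leq^~ x) s = 0.
  apply/eqP; rewrite -leqn0 leqNgt -has_count; apply/hasPn => z /y_le yz.
  by rewrite -ltnNge (leq_trans xy).
rewrite ltn0; apply/negbTE; rewrite -ltnNge (leq_trans xy) //.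
by case: i lt_i => [|i] //= lt_i; apply/y_le/mem_nth.
Qed.

Section IncreasingCount.

Variable n : nat.
Implicit Types P Q : {set 'I_n.+1}.

Definition count_upto P x := #|[set y in P | y <= x]|.

Lemma count_uptoE P x : count_upto P x = count (leq^~ x) (increasing P).
Proof.
rewrite (permP (permEl (perm_sort _ _))) count_map /count_upto cardE.
rewrite -size_filter; congr size.
rewrite /enum_mem -filter_predI; apply: eq_filter => y /=.
by rewrite !inE /= andbC.
Qed.

(** Counts are insensitive to how a set is enumerated, so this criterion lets
    the entrywise order be handled without ever computing an i-th element. *)
Lemma pin_le_count_upto k P Q : #|P| = k -> #|Q| = k ->
  (forall x, count_upto Q x <= count_upto P x) -> pin_le k P Q.
Proof.
move=> cP cQ QP; apply/forallP => i.
have srt R : sorted leq (increasing R) by apply: sort_sorted; apply: leq_total.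
rewrite sorted_nth_leE // ?size_increasing ?cP // -count_uptoE.
apply: leq_trans (QP _).
by rewrite count_uptoE -sorted_nth_leE // size_increasing cQ.
Qed.

End IncreasingCount.

(** * The set of partial sums *)

Section PartialSums.

Variables (n k : nat) (h : k.-tuple nat).
Hypotheses (h_gt0 : all (ltn 0) h) (h_sum : sumn h = n).

Lemma partial_sumsE :
  partial_sums n h = [set inord (sumn (take i.+1 h)) | i : 'I_k].
Proof.
have le_n m : sumn (take m h) < n.+1 by rewrite ltnS -h_sum sumn_take_le.
apply/setP => x; rewrite inE; apply/existsP/imsetP => [[i /eqP Dx]|[i _ ->]].
  exists i => //; apply: val_inj.
  by rewrite /= inordK // Dx -sumn_take_tnth //; apply: eq_bigl => j; rewrite ltnS.
exists i; rewrite /= inordK //.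
by apply/eqP; rewrite -sumn_take_tnth //; apply: eq_bigl => j; rewrite ltnS.
Qed.

Lemma partial_sum_inj :
  injective (fun i : 'I_k => inord (sumn (take i.+1 h)) : 'I_n.+1).
Proof.
have le_n m : sumn (take m h) < n.+1 by rewrite ltnS -h_sum sumn_take_le.
move=> i j /(congr1 val); rewrite /= !inordK // => eq_ij; apply: val_inj.
case: (ltngtP i j) => // lt_ij; move: eq_ij => /eqP.
  by rewrite ltn_eqF // sumn_take_lt ?size_tuple.
by rewrite gtn_eqF // sumn_take_lt ?size_tuple.
Qed.

Lemma card_partial_sums : #|partial_sums n h| = k.
Proof.
by rewrite partial_sumsE card_imset ?card_ord //; apply: partial_sum_inj.
Qed.

Lemma count_upto_partial_sums m x :
  m <= k -> sumn (take m h) <= x -> m <= count_upto (partial_sums n h) x.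
Proof.
have le_n j : sumn (take j h) < n.+1 by rewrite ltnS -h_sum sumn_take_le.
move=> le_mk le_x.
pose p (i : 'I_m) : 'I_n.+1 := inord (sumn (take (widen_ord le_mk i).+1 h)).
have p_inj : injective p.
  by move=> i j /partial_sum_inj/(congr1 val) /= eq_ij; apply: val_inj.
rewrite -{1}(card_ord m) -(card_imset _ p_inj); apply: subset_leq_card.
apply/subsetP => y /imsetP[i _ ->]; rewrite inE partial_sumsE; apply/andP; split.
  exact: (imset_f (fun i : 'I_k => inord (sumn (take i.+1 h)))).
rewrite /p inordK // (leq_trans _ le_x) //=.
move: (ltn_ord i); rewrite leq_eqVlt => /orP[/eqP->//|lt_im].
by apply/ltnW/sumn_take_lt; rewrite ?size_tuple.
Qed.

End PartialSums.

(** * Connected components *)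

Section Graph.

Variables (V : finType) (e : rel V).
Hypotheses (e_sym : symmetric e) (e_irr : irreflexive e).

Let conn_sym : connect_sym e. Proof. exact: sym_connect_sym e_sym. Qed.

Definition component x := [set y | connect e x y].

Lemma component_eq x y : (component x == component y) = connect e x y.
Proof.
apply/eqP/idP => [/setP/(_ y)|xy]; first by rewrite !inE connect0.
by apply/setP => z; rewrite !inE (same_connect conn_sym xy).
Qed.

Lemma componentsE : components e = [set component x | x : V].
Proof.
apply/setP=> C; apply/imsetP/imsetP => -[x _ ->]; exists x => //;
  by apply/setP => y; rewrite !inE.
Qed.

Lemma component_in x : component x \in components e.
Proof. by rewrite componentsE imset_f. Qed.

Lemma mem_component C x : C \in components e -> (x \in C) = (component x == C).
Proof.
by rewrite componentsE => /imsetP[y _ ->]; rewrite inE component_eq conn_sym.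
Qed.

Lemma card_vertices_in (A : {set {set V}}) : A \subset components e ->
  #|[set x | component x \in A]| = \sum_(C in A) #|C|.
Proof.
move=> /subsetP sA.
rewrite -sum1_card (partition_big component (mem A)) => [|x]; last by rewrite inE.
apply: eq_bigr => C; rewrite /= => CA; rewrite -sum1_card; apply: eq_bigl => x.
rewrite inE (mem_component _ (sA _ CA)).
by case: eqP => [->|_]; rewrite ?andbF // andbT.
Qed.

Lemma component_sizes_gt0_sum (n k : nat) (h : k.-tuple nat) : #|V| = n ->
  perm_eq h [seq #|C| | C : {set V} in components e] ->
  all (ltn 0) h /\ sumn h = n.
Proof.
move=> card_V h_sizes; split.
  rewrite (perm_all _ h_sizes); apply/allP => c /mapP[C].
  rewrite mem_enum componentsE => /imsetP[x _ ->] ->; apply/card_gt0P.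
  by exists x; rewrite inE connect0.
rewrite (perm_sumn h_sizes) sumnE big_map big_enum -card_vertices_in //=.
rewrite -card_V -cardsT; congr #|pred_of_set _|; apply/setP => x.
by rewrite !inE component_in.
Qed.

(** * Labelings with one pinnacle per component *)

Section Labeling.

Variables (n : nat) (lam : {ffun V -> 'I_n.+1}).
Hypothesis lam_labeling : labeling lam.

Let lam_inj : injective lam.
Proof. by case/andP: lam_labeling => /injectiveP. Qed.

Definition pinnacle_vertices := [set u | is_pinnacle e lam u].

Lemma pinnaclesE : pinnacles e lam = lam @: pinnacle_vertices.
Proof.
apply/setP=> x; apply/imsetP/imsetP => -[u]; rewrite ?inE => pu ->;
  by exists u; rewrite ?inE.
Qed.

Lemma component_max_pinnacle x : exists2 u, u \in pinnacle_vertices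
  & component u = component x /\ forall v, v \in component x -> lam v <= lam u.
Proof.
have x_in : x \in component x by rewrite inE connect0.
case: (@arg_maxnP _ x (mem (component x)) (fun v => lam v) x_in) => u.
rewrite /= inE => xu u_max.
exists u; last by split=> //; apply/eqP; rewrite component_eq conn_sym.
rewrite inE; apply/forallP => v; apply/implyP => uv.
rewrite ltn_neqAle; apply/andP; split; last first.
  by apply: u_max; rewrite /= inE (connect_trans xu) ?connect1.
apply/eqP => /val_inj/lam_inj eq_vu.
by move: uv; rewrite eq_vu e_irr.
Qed.

Lemma component_pinnacle_onto : component @: pinnacle_vertices = components e.
Proof.
apply/setP => C; rewrite componentsE.
apply/imsetP/imsetP => [[u _ ->]|[x _ ->]].
  by exists u.
by have [u pu [<- _]] := component_max_pinnacle x; exists u.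
Qed.

Hypothesis one_pinnacle : #|pinnacles e lam| = #|components e|.

(** The map from pinnacles to components is onto, so equal cardinalities make it
    injective. *)
Lemma component_pinnacle_inj : {in pinnacle_vertices &, injective component}.
Proof.
apply/imset_injP; rewrite component_pinnacle_onto -one_pinnacle pinnaclesE.
by rewrite card_imset.
Qed.

(** The component of [u] has its maximum at some pinnacle, which can only be
    [u]. *)
Lemma pinnacle_max u v :
  u \in pinnacle_vertices -> v \in component u -> lam v <= lam u.
Proof.
move=> pu; have [w pw [eq_wu w_max]] := component_max_pinnacle u.
by rewrite -[in lam u](component_pinnacle_inj pw pu eq_wu); apply: w_max.
Qed.

(** Labels are positive, so those that are at most [x] lie among [x] values. *)
Lemma card_label_le x : #|[set v | lam v <= x]| <= x.
Proof.
rewrite cardE -(size_map (fun v => val (lam v))) -{2}(size_iota 1 x).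
apply: uniq_leq_size => [|y /mapP[v]].
  by rewrite map_inj_uniq ?enum_uniq // => u v /val_inj/lam_inj.
rewrite mem_enum inE => le_v ->; rewrite mem_iota add1n ltnS le_v andbT.
have /andP[_ /eqP/setP/(_ (lam v))] := lam_labeling.
by rewrite imset_f // inE => <-.
Qed.

(** The key inequality of the lower bound: if m pinnacles are at most [x], the m
    components below them only carry labels in [1, x]. *)
Lemma sumn_take_count_upto (h : seq nat) x : sorted leq h ->
  perm_eq h [seq #|C| | C : {set V} in components e] ->
  sumn (take (count_upto (pinnacles e lam) x) h) <= x.
Proof.
move=> h_sorted h_sizes.
pose U := [set u in pinnacle_vertices | lam u <= x]; pose A := component @: U.
have sub_A : A \subset components e.
  by apply/subsetP => C /imsetP[u _ ->]; apply: component_in.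
have -> : count_upto (pinnacles e lam) x = #|A|.
  rewrite card_in_imset => [|u v]; last first.
    rewrite !inE => /andP[pu _] /andP[pv _].
    by apply: component_pinnacle_inj; rewrite inE.
  rewrite -(card_imset _ lam_inj); congr #|pred_of_set _|; apply/setP => y.
  rewrite inE pinnaclesE; apply/andP/imsetP => [[/imsetP[u pu ->] ux]|[u]].
    by exists u => //; rewrite inE pu.
  by rewrite inE => /andP[pu ux] ->; rewrite imset_f.
pose s := [seq #|C| | C : {set V} in A].
have sub_s : subseq s [seq #|C| | C : {set V} in components e].
  exact/map_subseq/subset_enum_subseq.
rewrite -(size_image (fun C : {set V} => #|C|) A).
apply: leq_trans (sumn_take_le_perm h_sorted h_sizes sub_s) _.
rewrite sumnE big_map big_enum -card_vertices_in //=.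
apply: leq_trans (card_label_le x); apply: subset_leq_card.
apply/subsetP => v; rewrite !inE => /imsetP[u].
rewrite inE => /andP[pu le_ux] eq_vu; apply: leq_trans le_ux.
by apply: pinnacle_max => //; rewrite -eq_vu inE connect0.
Qed.

End Labeling.

(** * The labeling induced by an injective key *)

Section RankLabeling.

Variables (n : nat) (f : V -> nat).
Hypotheses (card_V : #|V| = n) (f_inj : injective f).

Definition rank_labeling : {ffun V -> 'I_n.+1} :=
  [ffun x => inord #|[set y | f y <= f x]|].

Lemma rank_labelingE x : rank_labeling x = #|[set y | f y <= f x]| :> nat.
Proof. by rewrite ffunE inordK // ltnS -card_V max_card. Qed.

Lemma rank_labeling_lt x y : (rank_labeling x < rank_labeling y) = (f x < f y).
Proof.
have mono a b : f a <= f b -> rank_labeling a <= rank_labeling b.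
  move=> ab; rewrite !rank_labelingE; apply/subset_leq_card/subsetP => z.
  by rewrite !inE => /leq_trans; apply.
case: (leqP (f y) (f x)) => [/mono|xy]; first by rewrite leqNgt => /negbTE.
rewrite !rank_labelingE; apply/proper_card/properP; split.
  by apply/subsetP => z; rewrite !inE => /leq_trans; apply; apply: ltnW.
by exists y; rewrite !inE // -ltnNge.
Qed.

Lemma rank_labeling_inj : injective rank_labeling.
Proof.
move=> x y eq_xy; apply: f_inj; case: (ltngtP (f x) (f y)) => //;
  by rewrite -rank_labeling_lt eq_xy ltnn.
Qed.

Lemma rank_labelingP : labeling rank_labeling.
Proof.
apply/andP; split; first exact/injectiveP/rank_labeling_inj.
rewrite eqEcard; apply/andP; split.
  apply/subsetP => _ /imsetP[x _ ->]; rewrite inE rank_labelingE.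
  by apply/card_gt0P; exists x; rewrite inE.
rewrite (card_imset _ rank_labeling_inj) card_V.
have -> : interval n = [set~ ord0].
  by apply/setP => x; rewrite !inE lt0n -(inj_eq val_inj).
by rewrite cardsC1 card_ord.
Qed.

End RankLabeling.

(** * Distance to the root of a component *)

Definition walk_to x m :=
  [exists p : m.-tuple V, path e (root e x) p && (last (root e x) p == x)].

Lemma walk_toP x m :
  reflect (exists p, [/\ path e (root e x) p, last (root e x) p = x & size p = m])
          (walk_to x m).
Proof.
apply: (iffP existsP) => [[p /andP[ep /eqP lp]]|[p [ep lp /eqP sp]]].
  by exists p; rewrite size_tuple.
by exists (Tuple sp); rewrite /= ep lp eqxx.
Qed.

Lemma walk_to_ex x : exists m, walk_to x m.
Proof.
have: connect e (root e x) x by rewrite conn_sym connect_root.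
by case/connectP => p ep lp; exists (size p); apply/walk_toP; exists p.
Qed.

Definition depth x := ex_minn (walk_to_ex x).

(** A shortest walk is a path, which repeats no vertex. *)
Lemma depth_lt x : depth x < #|V|.
Proof.
rewrite /depth; case: ex_minnP => m /walk_toP[p [ep lp _]] m_min.
move: lp; case/shortenP: ep => q eq uq _ lq.
apply: leq_trans (_ : size (root e x :: q) <= _).
  by rewrite ltnS; apply: m_min; apply/walk_toP; exists q.
by rewrite -(card_uniqP uq) max_card.
Qed.

Lemma depth0 x : (depth x == 0) = (root e x == x).
Proof.
rewrite /depth; case: ex_minnP => m /walk_toP[p [_ lp sp]] m_min.
apply/idP/eqP => [|rx]; first by rewrite -sp => /nilP p0; rewrite p0 in lp.
by rewrite -leqn0; apply: m_min; apply/walk_toP; exists [::].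
Qed.

Lemma depth_parent x : root e x != x -> exists2 y, e x y & depth y < depth x.
Proof.
rewrite -depth0 /depth.
case: ex_minnP => m /walk_toP[p [ep lp <-]] _.
case/lastP: p ep lp => [|p z] //.
rewrite rcons_path last_rcons size_rcons => /andP[ep ez] zx _.
rewrite {}zx in ez *.
exists (last (root e x) p); first by rewrite e_sym.
case: ex_minnP => m' _; apply; apply/walk_toP; exists p.
(* the walk to the neighbor must start at its own root *)
suff -> : root e (last (root e x) p) = root e x by [].
by apply/(rootP conn_sym)/connect1.
Qed.

(** * Labeling the components by increasing size *)

Section Construction.

Variables (n k : nat) (h : k.-tuple nat).
Hypotheses (card_V : #|V| = n) (card_comp : #|components e| = k).
Hypothesis h_sizes : perm_eq h [seq #|C| | C : {set V} in components e].
Hypothesis h_sorted : sorted leq h.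

Definition components_by_size :=
  sort (fun C D : {set V} => #|C| <= #|D|) (enum (components e)).

Lemma map_card_components_by_size :
  [seq #|C| | C : {set V} <- components_by_size] = h.
Proof.
apply: (sorted_eq leq_trans anti_leq) => //.
  by rewrite sorted_map; apply: sort_sorted => C D; apply: leq_total.
by rewrite perm_sym (permPl h_sizes) perm_map // perm_sym perm_sort.
Qed.

Lemma components_by_size_uniq : uniq components_by_size.
Proof. by rewrite sort_uniq enum_uniq. Qed.

Lemma size_components_by_size : size components_by_size = k.
Proof. by rewrite size_sort -cardE. Qed.

Lemma mem_components_by_size C : (C \in components_by_size) = (C \in components e).
Proof. by rewrite mem_sort mem_enum. Qed.

Definition component_rank x := index (component x) components_by_size.

Lemma component_rank_lt x : component_rank x < k.
Proof.
rewrite -size_components_by_size index_mem.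
by rewrite mem_components_by_size component_in.
Qed.

Lemma card_component_rank_lt m : #|[set x | component_rank x < m]| = sumn (take m h).
Proof.
have -> : [set x | component_rank x < m]
    = [set x | component x \in [set C in take m components_by_size]].
  by apply/setP => x; rewrite !inE in_take // mem_components_by_size component_in.
rewrite card_vertices_in; last first.
  by apply/subsetP => C; rewrite inE => /mem_take; rewrite mem_components_by_size.
rewrite -map_card_components_by_size -map_take sumnE big_map.
rewrite big_uniq ?take_uniq ?components_by_size_uniq //=.
by apply: eq_bigl => C; rewrite inE.
Qed.

(** The lexicographic order on (rank of the component, decreasing depth, rank in
    an arbitrary enumeration), written as one number in base [#|V|].  The last
    digit only serves to break ties. *)
Definition block_key x :=
  (component_rank x * #|V| + (#|V| - (depth x).+1)) * #|V| + enum_rank x.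

Lemma block_key_lt_rank x y :
  component_rank x < component_rank y -> block_key x < block_key y.
Proof.
move=> lt_xy; apply: mixed_radix_lt; first exact: ltn_ord.
by apply: mixed_radix_lt => //; have := depth_lt x; lia.
Qed.

Lemma block_key_lt_depth x y :
  component_rank x = component_rank y -> depth y < depth x ->
  block_key x < block_key y.
Proof.
move=> eq_xy lt_yx; apply: mixed_radix_lt; first exact: ltn_ord.
by rewrite eq_xy ltn_add2l; have := depth_lt x; lia.
Qed.

Lemma block_key_inj : injective block_key.
Proof.
move=> x y /(congr1 (modn^~ #|V|)); rewrite !modnMDl !modn_small ?ltn_ord //.
by move/val_inj/enum_rank_inj.
Qed.

Lemma component_rank_connect x y :
  connect e x y -> component_rank x = component_rank y.
Proof. by rewrite -component_eq => /eqP eq_xy; rewrite /component_rank eq_xy. Qed.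

Lemma component_rank_inj x y : component_rank x = component_rank y -> connect e x y.
Proof.
move=> eq_xy; rewrite -component_eq; apply/eqP.
by apply: (index_inj set0 _ _ eq_xy); rewrite mem_components_by_size component_in.
Qed.

(** A root comes after its whole component and before all later components, so
    its label counts the vertices of the components up to its own. *)
Lemma block_key_le_root x y :
  root e x = x ->
  (block_key y <= block_key x) = (component_rank y <= component_rank x).
Proof.
move=> rx; case: (ltngtP (component_rank y) (component_rank x)) => [||eq_yx].
    by move=> /block_key_lt_rank/ltnW ->.
  by move=> /block_key_lt_rank; rewrite ltnNge => /negbTE.
have [->|yx] := eqVneq y x; first by rewrite leqnn.
apply/ltnW/block_key_lt_depth => //.
have /eqP-> : depth x == 0 by rewrite depth0 rx.
rewrite lt0n depth0; apply: contraNneq yx => <-.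
by rewrite -rx; apply/eqP/esym/(rootP conn_sym)/component_rank_inj.
Qed.

Definition block_labeling := rank_labeling n block_key.

Lemma is_pinnacle_block x : is_pinnacle e block_labeling x = (root e x == x).
Proof.
apply/forallP/eqP => [px|rx y].
  apply/eqP/negPn/negP => /depth_parent[y xy lt_yx].
  have := implyP (px y) xy; rewrite rank_labeling_lt // ltnNge ltnW //.
  by apply: block_key_lt_depth => //; apply/component_rank_connect/connect1.
apply/implyP => xy; rewrite rank_labeling_lt // ltn_neqAle (inj_eq block_key_inj).
rewrite block_key_le_root // (component_rank_connect (connect1 xy)) leqnn andbT.
by apply: contraTneq xy => ->; rewrite e_irr.
Qed.

Lemma block_label_root x :
  root e x = x ->
  block_labeling x = sumn (take (component_rank x).+1 h) :> nat.
Proof.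
move=> rx; rewrite rank_labelingE // -card_component_rank_lt.
by congr #|pred_of_set _|; apply/setP => y; rewrite !inE block_key_le_root.
Qed.

Lemma pinnacles_block_labeling : pinnacles e block_labeling = partial_sums n h.
Proof.
have [h_gt0 h_sum] := component_sizes_gt0_sum card_V h_sizes.
rewrite partial_sumsE //; apply/setP => y.
apply/imsetP/imsetP => [[x]|[i _ ->]].
  rewrite inE is_pinnacle_block => /eqP rx ->.
  exists (Ordinal (component_rank_lt x)) => //.
  by rewrite /= -block_label_root // inord_val.
have lt_i : i < size components_by_size by rewrite size_components_by_size.
have := mem_nth set0 lt_i; rewrite mem_components_by_size componentsE => /imsetP[x _ Dx].
exists (root e x); first by rewrite inE is_pinnacle_block root_root.
apply: val_inj; rewrite /= block_label_root ?root_root //.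
rewrite -(component_rank_connect (connect_root e x)) /component_rank -Dx.
rewrite index_uniq ?components_by_size_uniq //.
by rewrite inordK // ltnS -h_sum sumn_take_le.
Qed.

End Construction.
End Graph.

Theorem theorem5p6 (V : finType) (e : rel V)
  (e_sym : symmetric e) (e_irr : irreflexive e)
  (n k : nat) (card_V : #|V| = n) (card_comp : #|components e| = k)
  (h : k.-tuple nat)
  (h_sizes : perm_eq h [seq #|C| | C : {set V} in components e])
  (h_sorted : sorted leq h) :
  minimum_of (Pin e n k) (@pin_le n k) (partial_sums n h).
Proof.
have [h_gt0 h_sum] := component_sizes_gt0_sum e_sym card_V h_sizes.
have card_P := card_partial_sums h_gt0 h_sum.
split=> [|Q].
  rewrite inE card_P eqxx /=; apply/andP; split.
    apply/subsetP => x; rewrite partial_sumsE // inE => /imsetP[i _ ->].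
    rewrite inordK ?ltnS -?h_sum ?sumn_take_le //.
    (* the empty partial sum lies strictly below all the others *)
    apply: leq_ltn_trans (leq0n (sumn (take 0 h))) _.
    by rewrite sumn_take_lt ?size_tuple.
  apply/existsP; exists (block_labeling e_sym n).
  apply/andP; split; first exact/rank_labelingP/block_key_inj.
  exact/eqP/pinnacles_block_labeling.
rewrite inE => /andP[/eqP card_Q /andP[_ /existsP[lam /andP[lamP /eqP DQ]]]].
apply: pin_le_count_upto => // x; apply: count_upto_partial_sums => //.
  by rewrite -card_Q; apply/subset_leq_card/subsetP => y; rewrite inE => /andP[].
by rewrite -DQ; apply: sumn_take_count_upto => //; rewrite DQ card_Q.
Qed.
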